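(* Assume there are constants $K_{\partial\Omega,\Omega},L_{\partial\Omega,\Omega},K_1$ such that for all $f\in C^1(\Omega)$ $$\mathrm{Var}_{\lambda_{\partial\Omega}}(f)\le K_{\partial\Omega,\Omega}\int_\Omega|\nabla f|^2\,d\lambda_\Omega,\qquad \mathrm{Ent}_{\lambda_{\partial\Omega}}(f^2)\le L_{\partial\Omega,\Omega}\int_\Omega|\nabla f|^2\,d\lambda_\Omega,$$ $$\Bigl(\int_\Omega f\,d\lambda_\Omega-\int_{\partial\Omega}f\,d\lambda_{\partial\Omega}\Bigr)^2\le K_1\int_\Omega|\nabla f|^2\,d\lambda_\Omega.$$ Then for every $\alpha\in(0,1)$ $$\hat L_\alpha\le L_\Omega+\frac{1-\alpha}{\alpha}L_{\partial\Omega,\Omega}+\frac{(1-\alpha)(\log\alpha-\log(1-\alpha))}{2\alpha-1}\bigl(C_\Omega+K_{\partial\Omega,\Omega}+K_1\bigr).$$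
   Context: $\Omega$ is a smooth compact connected Riemannian manifold of dimension $d\ge2$ with smooth connected boundary $\partial\Omega$. $\lambda_\Omega$ and $\lambda_{\partial\Omega}$ are the normalised volume measure on $\Omega$ and the normalised $(d-1)$-dimensional Hausdorff measure on $\partial\Omega$. For $\alpha\in(0,1)$, $\lambda_\alpha=\alpha\lambda_\Omega+(1-\alpha)\lambda_{\partial\Omega}$ and $\hat{\mathcal E}_\alpha(f)=\alpha\int_\Omega|\nabla f|^2d\lambda_\Omega$. $\mathrm{Var}_\mu(f)=\int f^2d\mu-(\int f\,d\mu)^2$ and $\mathrm{Ent}_\mu(f^2)=\int f^2\log(f^2)\,d\mu-\bigl(\int f^2d\mu\bigr)\log\bigl(\int f^2d\mu\bigr)$. $\hat L_\alpha$ is the optimal constant with $\mathrm{Ent}_{\lambda_\alpha}(f^2)\le\hat L_\alpha\hat{\mathcal E}_\alpha(f)$ for all $f\in C^1(\Omega)$. $C_\Omega$, $L_\Omega$ are the optimal constants in $\mathrm{Var}_{\lambda_\Omega}(f)\le C_\Omega\int_\Omega|\nabla f|^2d\lambda_\Omega$ and $\mathrm{Ent}_{\lambda_\Omega}(f^2)\le L_\Omega\int_\Omega|\nabla f|^2d\lambda_\Omega$, $f\in C^1(\Omega)$ (Neumann Poincaré and logarithmic Sobolev constants of $\Omega$). At $\alpha=1/2$ the quotient $\frac{\log\alpha-\log(1-\alpha)}{2\alpha-1}$ is understood as its limit $2$. *)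

(* Defs.v *)
From HB Require Import structures.
From mathcomp Require Import all_boot all_order all_algebra.
From mathcomp Require Import all_classical all_reals all_analysis.

Set Implicit Arguments.
Unset Strict Implicit.
Unset Printing Implicit Defensive.

Import Order.TTheory GRing.Theory Num.Theory.
Import numFieldNormedType.Exports.

Local Open Scope classical_set_scope.
Local Open Scope ring_scope.

(** * C^k maps on open sets, and on arbitrary sets by local extension *)

(* All directional derivatives exist and are C^(k-1); for a finite-dimensional
   [V] this is the usual class C^k. *)
Fixpoint Ck (R : realType) (V W : normedModType R) (k : nat)
    (U : set V) (f : V -> W) : Prop :=
  (forall x, U x -> {for x, continuous f}) /\
  match k with
  | 0%N => True
  | k'.+1 => forall v : V,
      (forall x, U x -> derivable f x v) /\ Ck k' U (fun x => 'D_v f x)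
  end.

Definition Ck_on (R : realType) (V W : normedModType R) (k : nat)
    (A : set V) (f : V -> W) : Prop :=
  forall x, A x -> exists (U : set V) (F : V -> W),
    [/\ open U, U x, Ck k U F & forall y, U y -> A y -> F y = f y].

Definition smooth_on (R : realType) (V W : normedModType R)
    (A : set V) (f : V -> W) : Prop :=
  forall x, A x -> exists (U : set V) (F : V -> W),
    [/\ open U, U x, forall k, Ck k U F & forall y, U y -> A y -> F y = f y].

(* Directional derivative using only the values of [f] on [A]; it is one-sided
   where [A] is (boundary of a half-space, endpoint of an interval), and agrees
   with the derivative of any C^1 extension of [f]. *)
Definition derive_in (R : realType) (V W : normedModType R)
    (A : set V) (v : V) (f : V -> W) (x : V) : W :=
  lim ((fun h : R => h^-1 *: (f (x + h *: v) - f x)) @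
       within [set h : R | h != 0 /\ A (x + h *: v)] (nbhs (0 : R))).

(* Row [a] is the [a]-th partial derivative, so that a row vector [v] is pushed
   forward to [v *m jacobian A f x]. *)
Definition jacobian (R : realType) (m n : nat) (A : set 'rV[R]_m)
    (f : 'rV[R]_m -> 'rV[R]_n) (x : 'rV[R]_m) : 'M[R]_(m, n) :=
  \matrix_(a, b) (derive_in A (delta_mx 0 a : 'rV[R]_m) f x) 0 b.

(** * Smooth manifolds with boundary *)

Definition halfspace (R : realType) (d : nat) : set 'rV[R]_d :=
  [set u | forall a : 'I_d, val a = 0%N -> 0 <= u 0 a].

(* A smooth atlas on [T] with values in the half-space. [cinv i] is only
   meaningful on the image of [cmap i]. [chart_at] selects, for each point, a
   chart around it; [grad_sqnorm] and [speed] below do not depend on this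
   selection. *)
Record manifold (R : realType) (d : nat) (T : ptopologicalType) := Manifold {
  chart : Type ;
  cdom : chart -> set T ;
  cmap : chart -> T -> 'rV[R]_d ;
  cinv : chart -> 'rV[R]_d -> T ;
  chart_at : T -> chart ;
  chart_atP : forall x, cdom (chart_at x) x ;
  cdom_open : forall i, open (cdom i) ;
  cmap_image : forall i, exists2 O : set 'rV[R]_d,
    open O & cmap i @` cdom i = O `&` @halfspace R d ;
  cmapK : forall i x, cdom i x -> cinv i (cmap i x) = x ;
  cmap_continuous : forall i, {within cdom i, continuous (cmap i)} ;
  cinv_continuous : forall i,
    {within cmap i @` cdom i, continuous (cinv i)} ;
  transition_smooth : forall i j,
    smooth_on (cmap i @` (cdom i `&` cdom j)) (cmap j \o cinv i) }.

Definition boundary (R : realType) (d : nat) (T : ptopologicalType)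
    (M : manifold R d T) : set T :=
  [set x | exists i : chart M, cdom i x /\
             exists2 a : 'I_d, val a = 0%N & cmap i x 0 a = 0].

Definition C1_fun (R : realType) (d : nat) (T : ptopologicalType)
    (M : manifold R d T) (f : T -> R) : Prop :=
  forall i : chart M,
    Ck_on 1 (cmap i @` cdom i) (f \o cinv i : 'rV[R]_d -> R^o).

(** * Riemannian metrics *)

(* [metric i u] is the Gram matrix, at the point with coordinates [u], of the
   coordinate vector fields of the chart [i]. *)
Record riemannian (R : realType) (d : nat) (T : ptopologicalType)
    (M : manifold R d T) := Riemannian {
  metric : chart M -> 'rV[R]_d -> 'M[R]_d ;
  metric_sym : forall i x, cdom i x ->
    (metric i (cmap i x))^T = metric i (cmap i x) ;
  metric_pos : forall i x (v : 'rV[R]_d), cdom i x -> v != 0 ->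
    0 < (v *m metric i (cmap i x) *m v^T) 0 0 ;
  metric_smooth : forall i, smooth_on (cmap i @` cdom i) (metric i) ;
  metric_compat : forall i j x, cdom i x -> cdom j x ->
    let J := jacobian (cmap i @` (cdom i `&` cdom j)) (cmap j \o cinv i)
               (cmap i x) in
    metric i (cmap i x) = J *m metric j (cmap j x) *m J^T }.

(* Squared length of the tangent vector at [x] with components [v] in the chart
   [chart_at M x]. *)
Definition sqnorm_at (R : realType) (d : nat) (T : ptopologicalType)
    (M : manifold R d T) (g : riemannian M) (x : T) (v : 'rV[R]_d) : R :=
  let i := chart_at M x in (v *m metric g i (cmap i x) *m v^T) 0 0.

(* Components of the gradient of [f] at [x] in the chart [chart_at M x]. *)
Definition grad (R : realType) (d : nat) (T : ptopologicalType)
    (M : manifold R d T) (g : riemannian M) (f : T -> R) (x : T) : 'rV[R]_d :=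
  let i := chart_at M x in
  (\row_a derive_in (cmap i @` cdom i) (delta_mx 0 a)
            (f \o cinv i : 'rV[R]_d -> R^o) (cmap i x))
  *m invmx (metric g i (cmap i x)).

Definition grad_sqnorm (R : realType) (d : nat) (T : ptopologicalType)
    (M : manifold R d T) (g : riemannian M) (f : T -> R) (x : T) : R :=
  sqnorm_at g x (grad g f x).

(** * Riemannian distance and Hausdorff measures *)

Definition C1_curve (R : realType) (d : nat) (T : ptopologicalType)
    (M : manifold R d T) (c : R -> T) : Prop :=
  {within `[0, 1], continuous c} /\
  forall i : chart M,
    Ck_on 1 (`[0, 1]%classic `&` c @^-1` cdom i : set R^o)
      (cmap i \o c : R^o -> 'rV[R]_d).

Definition speed (R : realType) (d : nat) (T : ptopologicalType)
    (M : manifold R d T) (g : riemannian M) (c : R -> T) (t : R) : R :=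
  Num.sqrt (sqnorm_at g (c t)
    (derive_in (`[0, 1]%classic : set R^o) 1
       (cmap (chart_at M (c t)) \o c : R^o -> 'rV[R]_d) t)).

Definition curve_length (R : realType) (d : nat) (T : ptopologicalType)
    (M : manifold R d T) (g : riemannian M) (c : R -> T) : \bar R :=
  (\int[lebesgue_measure]_(t in `[0%R, 1%R]) (speed g c t)%:E)%E.

(* The curves are not required to be regular, so this is also the infimum over
   piecewise C^1 curves. *)
Definition rdist (R : realType) (d : nat) (T : ptopologicalType)
    (M : manifold R d T) (g : riemannian M) (x y : T) : \bar R :=
  ereal_inf [set curve_length g c | c in
    [set c : R -> T | [/\ C1_curve M c, c 0 = x & c 1 = y]]].

(* The maximum with 0 gives the empty set diameter 0. *)
Definition diam (R : realType) (d : nat) (T : ptopologicalType)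
    (M : manifold R d T) (g : riemannian M) (A : set T) : \bar R :=
  maxe 0%E (ereal_sup [set rdist g p.1 p.2 | p in A `*` A]).

Definition hausdorff_delta (R : realType) (d : nat) (T : ptopologicalType)
    (M : manifold R d T) (g : riemannian M) (s : nat) (delta : R)
    (A : set T) : \bar R :=
  ereal_inf [set (\sum_(0 <= k <oo) diam g (E k) ^+ s)%E | E in
    [set E : nat -> set T |
      A `<=` \bigcup_k E k /\ forall k, (diam g (E k) <= delta%:E)%E]].

(* The [s]-dimensional Hausdorff (outer) measure of the Riemannian distance,
   for an integer [s >= 1], up to a multiplicative constant depending on [s]. *)
Definition hausdorff (R : realType) (d : nat) (T : ptopologicalType)
    (M : manifold R d T) (g : riemannian M) (s : nat) (A : set T) : \bar R :=
  ereal_sup [set hausdorff_delta g s delta A | delta in [set e : R | 0 < e]].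

(** * Volume measure *)

Notation borel T := (g_sigma_algebraType (@open T)).

(* Lebesgue integral over R^n of a nonnegative Borel function (Tonelli). *)
Fixpoint lebesgue_integral_rV (R : realType) (n : nat) :
    ('rV[R]_n -> \bar R) -> \bar R :=
  match n with
  | 0%N => fun F => F 0
  | m.+1 => fun F => (\int[lebesgue_measure]_t
      lebesgue_integral_rV (fun v : 'rV[R]_m =>
        F (row_mx (t%:M : 'rV[R]_1) v : 'rV[R]_(1 + m))))%E
  end.

Definition is_volume (R : realType) (d : nat) (T : ptopologicalType)
    (M : manifold R d T) (g : riemannian M)
    (vol : {measure set (borel T) -> \bar R}) : Prop :=
  forall (i : chart M) (A : set (borel T)), measurable A -> A `<=` cdom i ->
    vol A = lebesgue_integral_rV (fun u : 'rV[R]_d =>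
      (Num.sqrt (\det (metric g i u)) * \1_(cmap i @` A) u)%:E).

(* [P setT = 1] forces the total mass of [m] to be positive and finite. *)
Definition is_normalisation (R : realType) (T : ptopologicalType)
    (m : set T -> \bar R) (P : probability (borel T) R) : Prop :=
  forall A : set (borel T), measurable A -> P A = (m A / m [set: T])%E.

Definition is_normalised_volume (R : realType) (d : nat) (T : ptopologicalType)
    (M : manifold R d T) (g : riemannian M)
    (P : probability (borel T) R) : Prop :=
  exists2 vol : {measure set (borel T) -> \bar R},
    is_volume g vol & is_normalisation vol P.

(* The boundary measure is extended by 0 to a measure on the whole manifold. *)
Definition is_normalised_boundary_measure (R : realType) (d : nat)
    (T : ptopologicalType) (M : manifold R d T) (g : riemannian M)
    (P : probability (borel T) R) : Prop :=
  is_normalisation (fun A => hausdorff g d.-1 (A `&` boundary M)) P.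

(** * Functional inequalities *)

Definition mixture (R : realType) (T : ptopologicalType) (a : {i01 R})
    (P Q : probability (borel T) R) : {measure set (borel T) -> \bar R} :=
  measure_add (mscale (a%:num)%:nng P) (mscale (1 - a%:num)%:nng Q).

Definition Var (R : realType) (T : ptopologicalType)
    (mu : {measure set (borel T) -> \bar R}) (f : T -> R) : R :=
  \int[mu]_x (f x ^+ 2) - (\int[mu]_x f x) ^+ 2.

(* [ln 0 = 0] in the library, hence 0 log 0 = 0. *)
Definition Ent (R : realType) (T : ptopologicalType)
    (mu : {measure set (borel T) -> \bar R}) (h : T -> R) : R :=
  \int[mu]_x (h x * ln (h x)) - (\int[mu]_x h x) * ln (\int[mu]_x h x).

Definition energy (R : realType) (d : nat) (T : ptopologicalType)
    (M : manifold R d T) (g : riemannian M)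
    (mu : {measure set (borel T) -> \bar R}) (f : T -> R) : R :=
  \int[mu]_x (grad_sqnorm g f x).

(* The best [C] with [Phi f <= C * E f] for all C^1 functions [f]; it is +oo if
   there is none. *)
Definition optimal_constant (R : realType) (d : nat) (T : ptopologicalType)
    (M : manifold R d T) (Phi E : (T -> R) -> R) : \bar R :=
  ereal_inf [set C%:E | C in
    [set C : R | forall f : T -> R, C1_fun M f -> Phi f <= C * E f]].

Definition poincare_constant (R : realType) (d : nat) (T : ptopologicalType)
    (M : manifold R d T) (g : riemannian M)
    (mu : {measure set (borel T) -> \bar R}) : \bar R :=
  optimal_constant M (Var mu) (energy g mu).

Definition logsobolev_constant (R : realType) (d : nat) (T : ptopologicalType)
    (M : manifold R d T) (g : riemannian M)
    (mu : {measure set (borel T) -> \bar R}) : \bar R :=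
  optimal_constant M (fun f => Ent mu (fun x => f x ^+ 2)) (energy g mu).

Definition mixture_logsobolev_constant (R : realType) (d : nat)
    (T : ptopologicalType) (M : manifold R d T) (g : riemannian M) (a : {i01 R})
    (P Q : probability (borel T) R) : \bar R :=
  optimal_constant M (fun f => Ent (mixture a P Q) (fun x => f x ^+ 2))
    (fun f => a%:num * energy g P f).

Definition log_quotient (R : realType) (a : R) : R :=
  if a == 2^-1 then 2 else (ln a - ln (1 - a)) / (2 * a - 1).

(* Main.v *)
Require Import Defs.
From HB Require Import structures.
From mathcomp Require Import all_boot all_order all_algebra.
From mathcomp Require Import all_classical all_reals all_analysis.
From mathcomp Require Import measurable_realfun ring lra.
Import Order.TTheory GRing.Theory Num.Theory.
Import numFieldNormedType.Exports.
Local Open Scope classical_set_scope.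
Local Open Scope ring_scope.

(** The entropy of a mixture splits into the average of the entropies of its
    two components and the entropy of a two-point distribution.  Write
    [NP], [NQ] for the integrals of [f ^ 2] under the components [P] and [Q];
    then

      Ent_mix (f^2) = a Ent_P (f^2) + (1 - a) Ent_Q (f^2) + Ent_b (h^2),

    where [b] is the Bernoulli law with weights [a] and [1 - a] and [h] takes
    the values [sqrt NP] and [sqrt NQ].  The sharp logarithmic Sobolev
    inequality of the two-point space ([bernoulli_logsobolev]) bounds the last
    term by [a (1 - a) log_quotient a (sqrt NP - sqrt NQ)^2], and since
    [sqrt NP * sqrt NQ] dominates the product of the two means, that square is
    at most [Var_P f + Var_Q f] plus the squared difference of the means.  All
    terms are now controlled by the energy ([Ent_mixture_le],
    [mixture_logsobolev_le]).

    The two-point inequality becomes an inequality in one real variable: after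
    normalising [h], the mass [s] of [h^2 b] on the first point is the only
    unknown, and the claim is that [s ln s + (1 - s) ln (1 - s) + 2 k sqrt (s
    (1 - s))] is maximal at [s = a] for the right [k].  In the variable
    [u = ln (s / (1 - s)) / 2] the negative of this function is, up to the
    constant [ln 2], [logit_profile k u]; it is even, and its derivative is
    [(k sinh u - u) / cosh u ^ 2].  As [sinh u / u] increases on the positive
    half-line, this has exactly the sign that makes the prescribed point the
    minimum.

    Geometry enters only through three facts: a C^1 function on a compact
    manifold is bounded and Borel, the energy is nonnegative, and it does not
    change when a constant is added to the function.

    The optimal constants are extended real numbers.  If one of [L] and [C]
    were [-oo] while the other is [+oo], the right-hand side would be [-oo]
    with no control on the left.  This is excluded by the classical comparison
    [C <= L] ([poincare_constant_le]), obtained from [Var f <= Ent (f^2)] for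
    [f >= 1], and by the converse remark that [C = -oo] makes every C^1
    function almost surely constant, hence [L = -oo] as well
    ([poincare_constant_Ny]). *)

Set Implicit Arguments.
Unset Strict Implicit.
Unset Printing Implicit Defensive.

(** * Hyperbolic functions and the logit profile *)

Definition sinh (R : realType) (u : R) : R := (expR u - expR (- u)) / 2.
Definition cosh (R : realType) (u : R) : R := (expR u + expR (- u)) / 2.

Lemma cosh_gt0 (R : realType) (u : R) : 0 < cosh u.
Proof. by rewrite divr_gt0 ?addr_gt0 ?expR_gt0. Qed.

Lemma coshN (R : realType) (u : R) : cosh (- u) = cosh u.
Proof. by rewrite /cosh opprK addrC. Qed.

Lemma sinhN (R : realType) (u : R) : sinh (- u) = - sinh u.
Proof. by rewrite /sinh opprK -mulNr opprB. Qed.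

Lemma sinh0 (R : realType) : sinh (0 : R) = 0.
Proof. by rewrite /sinh oppr0 subrr mul0r. Qed.

Lemma cosh2_sinh2 (R : realType) (u : R) : cosh u ^+ 2 - sinh u ^+ 2 = 1.
Proof.
rewrite /cosh /sinh expRN; have := expR_gt0 u; set e := expR u => e0.
by field; rewrite gt_eqF.
Qed.

Lemma is_derive_expRN (R : realType) (u : R) :
  is_derive u 1 (fun x : R => expR (- x)) (- expR (- u)).
Proof.
have h := is_derive1_comp (is_derive_expR (- u)) (is_deriveNid u (1 : R)).
by apply: is_derive_eq; rewrite mulrN1.
Qed.

Lemma is_derive_sinh (R : realType) (u : R) :
  is_derive u 1 (@sinh R) (cosh u).
Proof.
have h := is_derive_expRN u.
have -> : @sinh R = (fun x => 2^-1 *: (expR x - expR (- x)))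
  by apply/funext => x; rewrite /sinh mulrC.
by apply: is_derive_eq; rewrite opprK /cosh mulrC.
Qed.

Lemma is_derive_cosh (R : realType) (u : R) :
  is_derive u 1 (@cosh R) (sinh u).
Proof.
have h := is_derive_expRN u.
have -> : @cosh R = (fun x => 2^-1 *: (expR x + expR (- x)))
  by apply/funext => x; rewrite /cosh mulrC.
by apply: is_derive_eq; rewrite /sinh mulrC.
Qed.

Lemma MVT_derive (R : realType) (f df : R -> R) (a b : R) : a < b ->
  (forall x : R, is_derive x (1 : R) f (df x)) ->
  exists2 c, a < c < b & f b - f a = df c * (b - a).
Proof.
move=> ab fd; have [c cab e] : exists2 c, c \in `]a, b[%R & f b - f a = df c * (b - a).
  apply: MVT => //; apply: derivable_within_continuous => x _.
  by apply: ex_derive.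
by exists c => //; move: cab; rewrite in_itv.
Qed.

Lemma cosh_ndecr (R : realType) (u v : R) : 0 <= u -> u <= v -> cosh u <= cosh v.
Proof.
move=> u0; rewrite le_eqVlt => /predU1P[->//|uv].
have [c /andP[uc _] e] := MVT_derive uv (@is_derive_cosh R).
rewrite -subr_ge0 e mulr_ge0 ?subr_ge0 ?(ltW uv)// divr_ge0// subr_ge0 ler_expR.
by have := le_lt_trans u0 uc; lra.
Qed.

(** The chord slopes of [sinh] over [[0, u]] and [[u, v]] are values of its
    derivative [cosh] at two successive points, so they increase. *)
Lemma sinh_ratio_ndecr (R : realType) (u v : R) : 0 <= u -> u <= v ->
  sinh u * v <= u * sinh v.
Proof.
rewrite le_eqVlt => /predU1P[<-|u0]; first by rewrite sinh0 !mul0r.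
rewrite le_eqVlt => /predU1P[->|uv]; first by rewrite mulrC.
have [c /andP[c0 cu]] := MVT_derive u0 (@is_derive_sinh R).
have [c' /andP[uc' _]] := MVT_derive uv (@is_derive_sinh R).
rewrite sinh0 !subr0 => ev eu.
have := cosh_ndecr (ltW c0) (ltW (lt_trans cu uc')) => h.
have -> : sinh v = sinh u + cosh c' * (v - u) by rewrite -ev addrC subrK.
rewrite eu -subr_ge0.
have -> : u * (cosh c * u + cosh c' * (v - u)) - cosh c * u * v =
  (u * (v - u)) * (cosh c' - cosh c) by ring.
by rewrite !mulr_ge0 ?subr_ge0// ltW.
Qed.

Lemma sinh_ge_id (R : realType) (u : R) : 0 <= u -> u <= sinh u.
Proof.
rewrite le_eqVlt => /predU1P[<-|u0]; first by rewrite sinh0.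
have [c /andP[c0 _]] := MVT_derive u0 (@is_derive_sinh R).
rewrite sinh0 !subr0 => ->; rewrite ler_peMl ?(ltW u0)//.
rewrite (le_trans _ (cosh_ndecr (lexx 0) (ltW c0)))//.
by rewrite /cosh oppr0 expR0; lra.
Qed.

(** With [s = expR u / (expR u + expR (- u))] the first two terms are
    [- s ln s - (1 - s) ln (1 - s) - ln 2], and [1 / cosh u] is
    [2 sqrt (s (1 - s))]; see [logit_profileE]. *)
Definition logit_profile (R : realType) (k u : R) : R :=
  ln (cosh u) - u * sinh u / cosh u - k / cosh u.

Lemma is_derive_logit_profile (R : realType) (k u : R) :
  is_derive u 1 (logit_profile k) ((k * sinh u - u) / cosh u ^+ 2).
Proof.
have c0 := cosh_gt0 u.
have cn0 : cosh u != 0 by rewrite gt_eqF.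
have dc := is_derive_cosh u; have ds := is_derive_sinh u.
have dl := is_derive1_ln c0.
have dlc := is_derive1_comp dl dc.
have dv := is_deriveV cn0 dc.
have -> : logit_profile k = (fun x => (@ln R \o @cosh R) x
    - (x * sinh x) * (cosh x)^-1 - k *: (cosh x)^-1) by [].
apply: is_derive_eq; rewrite /= /GRing.scale /=.
have := cosh2_sinh2 u => e.
have -> : (k * sinh u - u) = k * sinh u - u * (cosh u ^+ 2 - sinh u ^+ 2) by rewrite e mulr1.
by field.
Qed.

(** The derivative of the profile has the sign of [k sinh u - u].  The
    equation [k sinh v = v] puts a zero of it at [v], and monotonicity of
    [sinh u / u] makes the sign there change from minus to plus.  At [v = 0]
    the equation is void, and [k = 1] is the limit of [v / sinh v]. *)
Lemma logit_profile_min (R : realType) (k u v : R) : 0 <= u -> 0 <= v ->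
  k * sinh v = v -> (v = 0 -> k = 1) ->
  logit_profile k v <= logit_profile k u.
Proof.
move=> u0 v0 kv k1.
(* The profile increases in the direction away from [v]. *)
have sgn w : 0 <= w -> 0 <= (k * sinh w - w) * (w - v).
  move=> w0; move: v0; rewrite le_eqVlt => /predU1P[v0|v0].
    by rewrite -v0 k1// subr0 mul1r mulr_ge0// subr_ge0 sinh_ge_id.
  have s0 : 0 < sinh v by apply: lt_le_trans v0 (sinh_ge_id (ltW v0)).
  have -> : k = v / sinh v by apply: (canRL (mulfK _) kv); rewrite gt_eqF.
  have -> : v / sinh v * sinh w - w =
    (sinh w * v - w * sinh v) / sinh v by field; rewrite gt_eqF.
  rewrite mulrAC divr_ge0 ?(ltW s0)//.
  have [wv|vw] := leP w v.
    by rewrite mulr_le0 ?subr_le0// sinh_ratio_ndecr.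
  by rewrite mulr_ge0 ?subr_ge0 ?(ltW vw)// mulrC [_ * v]mulrC sinh_ratio_ndecr// ltW.
have d := is_derive_logit_profile k.
case: (ltgtP u v) => [uv|vu|->//].
- have [c /andP[uc cv] e] := MVT_derive uv d.
  rewrite -subr_le0 e mulr_le0_ge0 ?subr_ge0 ?(ltW uv)//.
  rewrite mulr_le0_ge0 ?invr_ge0 ?sqr_ge0//.
  have := sgn c (ltW (le_lt_trans u0 uc)).
  by rewrite nmulr_lge0// subr_lt0.
- have [c /andP[vc cu] e] := MVT_derive vu d.
  rewrite -subr_ge0 e mulr_ge0 ?subr_ge0 ?(ltW vu)//.
  rewrite mulr_ge0 ?invr_ge0 ?sqr_ge0//.
  have := sgn c (ltW (le_lt_trans v0 vc)).
  by rewrite pmulr_lge0// subr_gt0.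
Qed.

Lemma logit_profile_norm (R : realType) (k u : R) :
  logit_profile k `|u| = logit_profile k u.
Proof.
case: (leP 0 u) => u0; first by rewrite ger0_norm.
by rewrite ltr0_norm// /logit_profile coshN sinhN mulrNN.
Qed.

(** * Logarithmic Sobolev inequality on the two-point space *)

Lemma expR_half_logit (R : realType) (m n : R) : 0 < m -> 0 < n ->
  expR ((ln m - ln n) / 2) = Num.sqrt m / Num.sqrt n.
Proof.
move=> m0 n0; apply/eqP; rewrite -(@eqrXn2 _ 2) ?expR_ge0 ?divr_ge0 ?sqrtr_ge0//.
rewrite -expRM_natr mulfVK// expRB !lnK ?posrE//.
by rewrite expr_div_n !sqr_sqrtr ?ltW.
Qed.

(** This form needs no case distinction: at [p = 1 / 2] both sides vanish. *)
Lemma log_quotientE (R : realType) (p : R) :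
  log_quotient p * (2 * p - 1) = ln p - ln (1 - p).
Proof.
rewrite /log_quotient; case: eqP => [->|/eqP p2].
  have -> : 1 - 2^-1 = 2^-1 :> R by field.
  by rewrite divff// !subrr mulr0.
rewrite divfK//; apply: contraNneq p2 => e; apply/eqP; lra.
Qed.

Lemma log_quotientC (R : realType) (p : R) :
  log_quotient (1 - p) = log_quotient p.
Proof.
have [->|p2] := eqVneq p 2^-1; first by congr log_quotient; field.
have h : 2 * p - 1 != 0 by apply: contraNneq p2 => e; apply/eqP; lra.
apply: (mulIf h); rewrite log_quotientE.
have -> : 2 * p - 1 = - (2 * (1 - p) - 1) by ring.
by rewrite mulrN log_quotientE opprB subKr.
Qed.

Lemma ln_le_subr1 (R : realType) (x : R) : 0 < x -> ln x <= x - 1.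
Proof.
by move=> x0; have := @le_ln1Dx R (x - 1); rewrite [1 + _]addrC subrK; apply; lra.
Qed.

(** The inverse of [log_quotient p] is the logarithmic mean of [p] and [1 - p],
    which lies below their maximum. *)
Lemma log_quotient_ge (R : realType) (p : R) : 0 < p -> p <= 1 - p ->
  1 <= log_quotient p * (1 - p).
Proof.
move=> p0; rewrite le_eqVlt => /predU1P[pq|pq].
  have p2 : p = 2^-1 by lra.
  by rewrite /log_quotient p2 eqxx; lra.
have q0 : 0 < 1 - p by exact: lt_trans pq.
have d0 : 2 * p - 1 < 0 by lra.
have := @ln_le_subr1 R (p / (1 - p)) (divr_gt0 p0 q0).
rewrite ln_div ?posrE// -log_quotientE => h; move: h.
have -> : p / (1 - p) - 1 = (2 * p - 1) / (1 - p).
  by field; rewrite gt_eqF.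
by rewrite mulrC ler_nM2l// -ler_pdivrMr// div1r.
Qed.

Lemma log_quotient_gt0 (R : realType) (p : R) : 0 < p -> p < 1 ->
  0 < log_quotient p.
Proof.
move=> p0 p1.
wlog pq : p p0 p1 / p <= 1 - p.
  move=> h; have [|pq] := leP p (1 - p); first exact: h.
  by rewrite -log_quotientC h//; lra.
have q0 : 0 < 1 - p by lra.
by rewrite -(pmulr_lgt0 _ q0) (lt_le_trans ltr01)// log_quotient_ge.
Qed.

(** The two-point inequality for a function vanishing at one point.  By
    [log_quotientE] the difference of the two sides is symmetric in [p] and
    [1 - p], so [p] may be taken to be the smaller weight; then the right-hand
    side is at least [p / (1 - p) = (1 - p)^-1 - 1]. *)
Lemma log_quotient_ge_ln (R : realType) (p : R) : 0 < p -> p < 1 ->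
  - ln (1 - p) <= log_quotient p * p.
Proof.
move=> p0 p1.
wlog pq : p p0 p1 / p <= 1 - p.
  move=> h; have [|pq] := leP p (1 - p); first exact: h.
  have : - ln (1 - (1 - p)) <= log_quotient (1 - p) * (1 - p) by apply: h; lra.
  have := log_quotientE p; rewrite log_quotientC subKr; lra.
have q0 : 0 < 1 - p by lra.
have h := ln_le_subr1 (_ : 0 < (1 - p)^-1).
rewrite -lnV ?posrE//; apply: le_trans (h _) _; first by rewrite invr_gt0.
have -> : (1 - p)^-1 - 1 = p / (1 - p) by field; rewrite gt_eqF.
rewrite ler_pdivrMr// mulrAC -ler_pdivrMr// divff ?gt_eqF//.
exact: log_quotient_ge.
Qed.

(** In terms of unnormalised masses [m], [n] of the two points. *)
Lemma logit_profileE (R : realType) (k m n : R) : 0 < m -> 0 < n ->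
  logit_profile k ((ln m - ln n) / 2) =
  ln (m + n) - (m * ln m + n * ln n) / (m + n) - ln 2
  - 2 * k * (Num.sqrt m * Num.sqrt n) / (m + n).
Proof.
move=> m0 n0; have em := expR_half_logit m0 n0.
have en : expR (- ((ln m - ln n) / 2)) = Num.sqrt n / Num.sqrt m.
  by rewrite -mulNr opprB expR_half_logit.
have := sqr_sqrtr (ltW m0); have := sqr_sqrtr (ltW n0).
have a0 : 0 < Num.sqrt m by rewrite sqrtr_gt0.
have b0 : 0 < Num.sqrt n by rewrite sqrtr_gt0.
have am0 : Num.sqrt m != 0 by rewrite gt_eqF.
have bn0 : Num.sqrt n != 0 by rewrite gt_eqF.
rewrite /logit_profile /cosh /sinh em en.
set a := Num.sqrt m in a0 am0 *; set b := Num.sqrt n in b0 bn0 * => bE aE.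
have lm : ln m = 2 * ln a by rewrite -aE lnXn// mulr_natl.
have ln' : ln n = 2 * ln b by rewrite -bE lnXn// mulr_natl.
have mn0 : 0 < m + n by rewrite addr_gt0.
have cE : (a / b + b / a) / 2 = (m + n) / (a * b * 2).
  by rewrite -aE -bE; field; rewrite am0 bn0.
rewrite cE ln_div ?posrE ?mulr_gt0// !lnM ?posrE ?mulr_gt0// lm ln'.
rewrite -aE -bE; field.
by rewrite am0 bn0 /= -?aE -?bE; rewrite aE bE gt_eqF.
Qed.

(** Minimality of the profile at the logit of [p], compared with the logit of
    the masses [p x^2] and [(1 - p) y^2].  The value [k] solving
    [k sinh v = v] is [log_quotient p * sqrt (p (1 - p))]. *)
Lemma bernoulli_logsobolev_pos (R : realType) (p x y : R) :
  0 < p -> p < 1 -> 0 < x -> 0 < y ->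
  p * (x ^+ 2 * ln (x ^+ 2)) + (1 - p) * (y ^+ 2 * ln (y ^+ 2))
  - (p * x ^+ 2 + (1 - p) * y ^+ 2) * ln (p * x ^+ 2 + (1 - p) * y ^+ 2)
  <= p * (1 - p) * log_quotient p * (x - y) ^+ 2.
Proof.
move=> p0 p1 x0 y0.
have q0 : 0 < 1 - p by lra.
set m := p * x ^+ 2; set n := (1 - p) * y ^+ 2.
have m0 : 0 < m by rewrite mulr_gt0 ?exprn_gt0.
have n0 : 0 < n by rewrite mulr_gt0 ?exprn_gt0.
have N0 : 0 < m + n by rewrite addr_gt0.
set a := Num.sqrt p; set b := Num.sqrt (1 - p).
have aE : a ^+ 2 = p by rewrite sqr_sqrtr ?ltW.
have bE : b ^+ 2 = 1 - p by rewrite sqr_sqrtr ?ltW.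
have a0 : 0 < a by rewrite sqrtr_gt0.
have b0 : 0 < b by rewrite sqrtr_gt0.
set L := log_quotient p.
pose k := L * (a * b).
pose v := (ln p - ln (1 - p)) / 2.
have kv : k * sinh v = v.
  rewrite /sinh /v (expR_half_logit p0 q0) -mulNr opprB (expR_half_logit q0 p0).
  rewrite -log_quotientE -/a -/b -/L /k.
  have -> : 2 * p - 1 = a ^+ 2 - b ^+ 2 by rewrite aE bE; ring.
  by field; rewrite !gt_eqF.
have k1 : v = 0 -> k = 1.
  rewrite /v => v0; have pq : p = 1 - p by apply: ln_inj; rewrite ?posrE//; lra.
  have p2' : p = 2^-1 by lra.
  have ab : a = b by rewrite /a /b; congr Num.sqrt.
  rewrite /k -ab -expr2 aE /L p2' /log_quotient eqxx; lra.
(* The profile is even, so both points can be moved to the positive side, where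
   its minimum is known. *)
have kv' : k * sinh `|v| = `|v|.
  by have [v0|v0] := leP 0 v; [rewrite ger0_norm|rewrite ltr0_norm// sinhN mulrN kv].
have := logit_profile_min (normr_ge0 ((ln m - ln n) / 2)) (normr_ge0 v) kv'
  (fun e => k1 (normr0_eq0 e)).
rewrite !logit_profile_norm /v !logit_profileE//.
have sm : Num.sqrt m = a * x by rewrite sqrtrM ?(ltW p0)// sqrtr_sqr gtr0_norm.
have sn : Num.sqrt n = b * y by rewrite sqrtrM ?(ltW q0)// sqrtr_sqr gtr0_norm.
have lm : ln m = ln p + ln (x ^+ 2) by rewrite lnM ?posrE ?exprn_gt0.
have ln' : ln n = ln (1 - p) + ln (y ^+ 2) by rewrite lnM ?posrE ?exprn_gt0.
rewrite sm sn lm ln' -/a -/b [p + _]addrC subrK ln1 !divr1 => h.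
(* After clearing the denominator and eliminating [ln p] the two inequalities
   differ only by a polynomial identity. *)
have := ler_wpM2r (ltW N0) h.
set X := ln (x ^+ 2); set Y := ln (y ^+ 2).
have -> : (ln (m + n) - (m * (ln p + X) + n * (ln (1 - p) + Y)) / (m + n) - ln 2 -
  2 * k * (a * x * (b * y)) / (m + n)) * (m + n) =
  (m + n) * ln (m + n) - (m * (ln p + X) + n * (ln (1 - p) + Y))  - ln 2 * (m + n) -
  2 * k * (a * x * (b * y)) by field; rewrite gt_eqF.
have -> : 2 * k * (a * x * (b * y)) = 2 * L * p * (1 - p) * (x * y).
  by rewrite -{1}aE -{1}bE /k; ring.
have -> : 2 * k * (a * b) = 2 * L * p * (1 - p).
  by rewrite -{1}aE -{1}bE /k; ring.
have := log_quotientE p; rewrite -/L => e.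
have -> : ln p = ln (1 - p) + L * (2 * p - 1) by rewrite e; ring.
rewrite !mulrA -/m -/n => {}h.
rewrite -subr_ge0 in h; rewrite -subr_ge0; apply: le_trans h _.
rewrite le_eqVlt; apply/orP; left; apply/eqP.
by rewrite /m /n; ring.
Qed.

Lemma bernoulli_logsobolev (R : realType) (p x y : R) :
  0 < p -> p < 1 -> 0 <= x -> 0 <= y ->
  p * (x ^+ 2 * ln (x ^+ 2)) + (1 - p) * (y ^+ 2 * ln (y ^+ 2))
  - (p * x ^+ 2 + (1 - p) * y ^+ 2) * ln (p * x ^+ 2 + (1 - p) * y ^+ 2)
  <= p * (1 - p) * log_quotient p * (x - y) ^+ 2.
Proof.
have atom (q z : R) : 0 < q -> q < 1 -> 0 <= z ->
    (1 - q) * (z ^+ 2 * ln (z ^+ 2)) - (1 - q) * z ^+ 2 * ln ((1 - q) * z ^+ 2)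
    <= q * (1 - q) * log_quotient q * z ^+ 2.
  move=> q0 q1; rewrite le_eqVlt => /predU1P[<-|z0].
    by rewrite expr0n/= !(mulr0, mul0r) subrr.
  have q'0 : 0 < 1 - q by lra.
  rewrite [ln ((1 - q) * _)]lnM ?posrE ?exprn_gt0//.
  have -> : (1 - q) * (z ^+ 2 * ln (z ^+ 2)) -
    (1 - q) * z ^+ 2 * (ln (1 - q) + ln (z ^+ 2)) =
    ((1 - q) * z ^+ 2) * (- ln (1 - q)) by ring.
  have -> : q * (1 - q) * log_quotient q * z ^+ 2 =
    ((1 - q) * z ^+ 2) * (log_quotient q * q) by ring.
  by rewrite ler_wpM2l ?log_quotient_ge_ln// ltW// mulr_gt0 ?exprn_gt0.
move=> p0 p1; rewrite le_eqVlt => /predU1P[<-|x0] y0.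
  have := atom p y p0 p1 y0.
  by rewrite expr0n/= !(mulr0, mul0r) !add0r sqrrN.
move: y0; rewrite le_eqVlt => /predU1P[<-|y0].
  have q0 : 0 < 1 - p by lra.
  have q1 : 1 - p < 1 by lra.
  have := atom (1 - p) x q0 q1 (ltW x0); rewrite log_quotientC subKr.
  by rewrite expr0n/= !(mulr0, mul0r) !addr0 subr0 [p * (1 - p)]mulrC.
exact: bernoulli_logsobolev_pos.
Qed.

(** * Means of bounded measurable functions *)

Definition bounded_measurable d (X : measurableType d) (R : realType)
    (f : X -> R) : Prop :=
  measurable_fun setT f /\ exists B, forall x, `|f x| <= B.

Section BoundedMeasurable.
Context (d : measure_display) (X : measurableType d) (R : realType).
Implicit Types (f h : X -> R) (P : probability X R).

Lemma bounded_measurable_cst (c : R) : bounded_measurable (fun _ : X => c).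
Proof. by split; [exact: measurable_cst|exists `|c|]. Qed.

Lemma bounded_measurableD f h : bounded_measurable f -> bounded_measurable h ->
  bounded_measurable (fun x => f x + h x).
Proof.
move=> [mf [B fB]] [mh [C hC]]; split; first exact: measurable_funD.
by exists (B + C) => x; rewrite (le_trans (ler_normD _ _))// lerD.
Qed.

Lemma bounded_measurableM f h : bounded_measurable f -> bounded_measurable h ->
  bounded_measurable (fun x => f x * h x).
Proof.
move=> [mf [B fB]] [mh [C hC]]; split; first exact: measurable_funM.
by exists (B * C) => x; rewrite normrM ler_pM.
Qed.

Lemma bounded_measurableX f n : bounded_measurable f ->
  bounded_measurable (fun x => f x ^+ n).
Proof.
move=> [mf [B fB]]; split; first exact: measurable_funX.
by exists (B ^+ n) => x; rewrite normrX lerXn2r// nnegrE (le_trans _ (fB x)).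
Qed.

(** Boundedness comes from [1 - 1 / y <= ln y <= y - 1]. *)
Lemma bounded_measurable_xlnx f : (forall x, 0 <= f x) ->
  bounded_measurable f -> bounded_measurable (fun x => f x * ln (f x)).
Proof.
move=> f0 [mf [B fB]]; split.
  by apply: measurable_funM => //; apply: measurableT_comp mf; exact: measurable_ln.
exists (1 + B ^+ 2) => x.
have := f0 x; rewrite le_eqVlt => /predU1P[<-|fx0].
  by rewrite mul0r normr0 addr_ge0 ?sqr_ge0.
have fxB : f x <= B by rewrite (le_trans _ (fB x))// ler_norm.
have l1 := ln_le_subr1 fx0.
have l2 := ln_le_subr1 (_ : 0 < (f x)^-1).
have {}l2 : - ln (f x) <= (f x)^-1 - 1 by rewrite -lnV ?posrE// l2 ?invr_gt0.
rewrite ler_norml; apply/andP; split; last first.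
  apply: (@le_trans _ _ (f x * f x)); first by rewrite ler_wpM2l// ?f0//; lra.
  rewrite -expr2 (@le_trans _ _ (B ^+ 2))// ?lerDr//.
  by rewrite lerXn2r// nnegrE ?f0// (le_trans (f0 x)).
have := ler_wpM2l (f0 x) l2; rewrite mulrBr divff ?gt_eqF// mulrN mulr1.
have := sqr_ge0 B; lra.
Qed.

Lemma bounded_measurable_integrable (mu : {measure set X -> \bar R}) f :
  (mu setT < +oo)%E -> bounded_measurable f ->
  mu.-integrable setT (EFin \o f).
Proof.
move=> mufin [mf [B fB]]; apply: measurable_bounded_integrable => //.
by exists B; split; [exact: num_real|move=> M BM x _; exact: le_trans (ltW BM)].
Qed.

Lemma probability_integrable P f : bounded_measurable f ->
  P.-integrable setT (EFin \o f).
Proof.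
have PT : (P setT < +oo)%E by rewrite probability_setT ltry.
exact: (bounded_measurable_integrable PT).
Qed.

Lemma mean_cst P (c : R) : \int[P]_x c = c.
Proof.
rewrite Rintegral_cst// -[RHS]mulr1; congr (_ * _).
exact: (congr1 fine (@probability_setT _ _ _ P)).
Qed.

Lemma meanD P f h : bounded_measurable f -> bounded_measurable h ->
  \int[P]_x (f x + h x) = \int[P]_x f x + \int[P]_x h x.
Proof.
by move=> bf bh; rewrite RintegralD//; exact: probability_integrable.
Qed.

Lemma meanZ P f (c : R) : bounded_measurable f ->
  \int[P]_x (c * f x) = c * \int[P]_x f x.
Proof.
by move=> bf; rewrite RintegralZl//; exact: probability_integrable.
Qed.

Lemma le_mean P f h : bounded_measurable f -> bounded_measurable h ->
  (forall x, f x <= h x) -> \int[P]_x f x <= \int[P]_x h x.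
Proof.
by move=> bf bh fh; apply: le_Rintegral => //; exact: probability_integrable.
Qed.

Lemma mean_sqrB P f (c : R) : bounded_measurable f ->
  \int[P]_x ((f x - c) ^+ 2) =
  \int[P]_x (f x ^+ 2) - 2 * c * (\int[P]_x f x) + c ^+ 2.
Proof.
move=> bf.
have b2 := bounded_measurableX 2 bf.
have bc := bounded_measurable_cst.
have bcf := bounded_measurableM (bc (- (2 * c))) bf.
have -> : \int[P]_x ((f x - c) ^+ 2) =
    \int[P]_x (f x ^+ 2 + - (2 * c) * f x + c ^+ 2).
  by apply: eq_Rintegral => x _; ring.
rewrite !meanD// ?mean_cst ?meanZ//.
  by rewrite mulNr.
exact: bounded_measurableD.
Qed.

Lemma sqr_mean_le P f : bounded_measurable f ->
  (\int[P]_x f x) ^+ 2 <= \int[P]_x (f x ^+ 2).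
Proof.
move=> bf; have := mean_sqrB P (\int[P]_x f x) bf.
have : 0 <= \int[P]_x ((f x - \int[P]_x f x) ^+ 2).
  by rewrite Rintegral_ge0// => x _; exact: sqr_ge0.
set V := \int[P]_x (_ ^+ 2); lra.
Qed.

End BoundedMeasurable.

(** Additivity and homogeneity of the integral in the measure are applied to
    nonnegative functions; adding a bound of [f] reduces to that case. *)
Lemma mean_mixture (R : realType) (T : ptopologicalType) (a : {i01 R})
    (P Q : probability (borel T) R) (f : borel T -> R) : bounded_measurable f ->
  \int[mixture a P Q]_x f x =
  a%:num * \int[P]_x f x + (1 - a%:num) * \int[Q]_x f x.
Proof.
have mixE (h : borel T -> R) : (forall x, 0 <= h x) -> bounded_measurable h ->
    (\int[mixture a P Q]_x (h x)%:E =
     (a%:num * \int[P]_x h x + (1 - a%:num) * \int[Q]_x h x)%:E)%E.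
  move=> h0 bh; have mh : measurable_fun setT (EFin \o h).
    by apply/measurable_EFinP; case: bh.
  have h0' (x : borel T) : setT x -> (0 <= (h x)%:E)%E by rewrite lee_fin.
  rewrite /mixture ge0_integral_measure_add//.
  have fin (S : probability (borel T) R) : (\int[S]_x (h x)%:E)%E \is a fin_num.
    exact/integrable_fin_num/probability_integrable.
  by rewrite !ge0_integral_mscale// -(fineK (fin P)) -(fineK (fin Q)).
move=> bf; have [_ [B fB]] := bf.
(* The total mass of the mixture is the integral of the constant 1. *)
have muT : (mixture a P Q setT < +oo)%E.
  have := mixE (fun=> 1) (fun=> ler01) (bounded_measurable_cst _ 1).
  by rewrite integral_cst// mul1e => ->; rewrite ltry.
have bB : bounded_measurable (fun _ : borel T => B) by exact: bounded_measurable_cst.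
have bfB := bounded_measurableD bf bB.
have B0 : 0 <= B by rewrite (le_trans _ (fB point)).
have fB0 x : 0 <= f x + B by have := fB x; rewrite ler_norml; lra.
have -> : \int[mixture a P Q]_x f x =
    \int[mixture a P Q]_x (f x + B) - \int[mixture a P Q]_x B.
  rewrite -RintegralB//; first by apply: eq_Rintegral => x _; rewrite addrK.
    exact: bounded_measurable_integrable.
  exact: bounded_measurable_integrable.
rewrite {1 2}/Rintegral !mixE//= !meanD// !mean_cst.
by ring.
Qed.

(** * Variance and entropy *)

Section VarianceEntropy.
Context (R : realType) (T : ptopologicalType).
Implicit Types (P Q : probability (borel T) R) (f : borel T -> R).

Lemma Var_ge0 P f : bounded_measurable f -> 0 <= Var P f.
Proof. by move=> bf; rewrite /Var subr_ge0 sqr_mean_le. Qed.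

Lemma Var_centered P f : bounded_measurable f ->
  Var P f = \int[P]_x ((f x - \int[P]_y f y) ^+ 2).
Proof. by move=> bf; rewrite (mean_sqrB P _ bf) /Var; ring. Qed.

Lemma VarD P f (c : R) : bounded_measurable f ->
  Var P (fun x => f x + c) = Var P f.
Proof.
move=> bf; have bc := bounded_measurable_cst (borel T) c.
rewrite !Var_centered//; last exact: bounded_measurableD.
rewrite (meanD P bf bc) (mean_cst P).
by apply: eq_Rintegral => x _; ring.
Qed.

(** The entropy lost by averaging the components separately is that of a
    two-point function, bounded by [bernoulli_logsobolev]. *)
Lemma Ent_mixture_le (a : {i01 R}) P Q f :
  0 < a%:num -> a%:num < 1 -> bounded_measurable f ->
  Ent (mixture a P Q) (fun x => f x ^+ 2) <=
    a%:num * Ent P (fun x => f x ^+ 2)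
    + (1 - a%:num) * Ent Q (fun x => f x ^+ 2)
    + a%:num * (1 - a%:num) * log_quotient a%:num
      * (Var P f + Var Q f + (\int[P]_x f x - \int[Q]_x f x) ^+ 2).
Proof.
move=> a0 a1 bf; have bf2 := bounded_measurableX 2 bf.
have bl := bounded_measurable_xlnx (fun x => sqr_ge0 (f x)) bf2.
have := sqr_mean_le P bf; have := sqr_mean_le Q bf.
rewrite /Ent /Var !(mean_mixture a P Q)//.
set mP := \int[P]_x f x; set mQ := \int[Q]_x f x.
set NP := \int[P]_x (f x ^+ 2); set NQ := \int[Q]_x (f x ^+ 2).
move=> hQ hP.
have NP0 : 0 <= NP by apply: le_trans hP; exact: sqr_ge0.
have NQ0 : 0 <= NQ by apply: le_trans hQ; exact: sqr_ge0.
have := bernoulli_logsobolev a0 a1 (sqrtr_ge0 NP) (sqrtr_ge0 NQ).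
rewrite !sqr_sqrtr// => h.
(* The two second moments play the role of [h^2] on the two-point space; it
   remains to compare their square roots with the means. *)
have cauchy : mP * mQ <= Num.sqrt NP * Num.sqrt NQ.
  have sP : `|mP| <= Num.sqrt NP by rewrite -sqrtr_sqr ler_wsqrtr.
  have sQ : `|mQ| <= Num.sqrt NQ by rewrite -sqrtr_sqr ler_wsqrtr.
  by rewrite (le_trans (ler_norm _))// normrM ler_pM.
have c0 : 0 <= a%:num * (1 - a%:num) * log_quotient a%:num.
  by rewrite !mulr_ge0 ?subr_ge0 ?(ltW a1)// ltW// log_quotient_gt0.
have : (Num.sqrt NP - Num.sqrt NQ) ^+ 2 <=
    NP - mP ^+ 2 + (NQ - mQ ^+ 2) + (mP - mQ) ^+ 2.
  have := sqr_sqrtr NP0; have := sqr_sqrtr NQ0; move: cauchy.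
  rewrite !sqrrB => *; lra.
move=> /(ler_wpM2l c0); lra.
Qed.

(** With [r^2] the integral of [f^2] and [m] that of [f], integrating
    [f^2 ln (f^2 / r^2) >= 2 f^2 (1 - r / f)] gives
    [Ent (f^2) >= 2 r (r - m)], which is at least [(r + m) (r - m) = Var f]
    as [m <= r]. *)
Lemma Var_le_Ent P f : bounded_measurable f -> (forall x, 1 <= f x) ->
  Var P f <= Ent P (fun x => f x ^+ 2).
Proof.
move=> bf f1; have bf2 := bounded_measurableX 2 bf.
have bl := bounded_measurable_xlnx (fun x => sqr_ge0 (f x)) bf2.
have bc := @bounded_measurable_cst _ (borel T) R.
have m1 : 1 <= \int[P]_x f x.
  by rewrite -[leLHS](mean_cst P) le_mean.
have := sqr_mean_le P bf.
rewrite /Var /Ent; set m := \int[P]_x f x in m1 *.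
set N := \int[P]_x (f x ^+ 2) => mN.
have N0 : 0 < N by apply: lt_le_trans mN; rewrite exprn_gt0//; lra.
pose r := Num.sqrt N.
have r0 : 0 < r by rewrite sqrtr_gt0.
have rE : r ^+ 2 = N by rewrite sqr_sqrtr// ltW.
have lnN : ln N = 2 * ln r by rewrite -rE lnXn// mulr_natl.
have mr : m <= r by rewrite -(@ler_pXn2r _ 2) ?nnegrE ?rE//; lra.
have : \int[P]_x ((ln N + 2) * f x ^+ 2 + - (2 * r) * f x) <=
    \int[P]_x (f x ^+ 2 * ln (f x ^+ 2)).
  apply: le_mean => //.
    by apply: bounded_measurableD; exact: bounded_measurableM.
  move=> x; have fx0 : 0 < f x by apply: lt_le_trans (f1 x).
  have := ln_le_subr1 (divr_gt0 r0 fx0); rewrite ln_div ?posrE//.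
  move=> /(ler_wpM2l (ltW (exprn_gt0 2 fx0))).
  rewrite lnN (lnXn 2 fx0) -[ln (f x) *+ 2]mulr_natl.
  have -> : f x ^+ 2 * (r / f x - 1) = f x * r - f x ^+ 2.
    by field; rewrite gt_eqF.
  lra.
rewrite meanD ?meanZ//; [|exact: bounded_measurableM..].
rewrite -/m -/N -rE => h.
have : 0 <= (r - m) * (r - m) by rewrite mulr_ge0 ?subr_ge0.
lra.
Qed.

(** A function of zero variance is almost surely equal to its mean, so all
    the integrals are evaluations there ([aeE]). *)
Lemma Ent_eq0_of_Var P f : bounded_measurable f -> Var P f = 0 ->
  Ent P (fun x => f x ^+ 2) = 0.
Proof.
move=> bf V0; have bf2 := bounded_measurableX 2 bf.
set m := \int[P]_x f x.
have bc := @bounded_measurable_cst _ (borel T) R.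
have bd : bounded_measurable (fun x => (f x - m) ^+ 2).
  exact: bounded_measurableX (bounded_measurableD bf (bc (- m))).
have mE (h : borel T -> R) : bounded_measurable h ->
    measurable_fun setT (fun x => (h x)%:E).
  by case=> mh _; exact/measurable_EFinP.
have fm : ae_eq P setT (fun x => ((f x - m) ^+ 2)%:E) (cst 0%E).
  apply/ae_eq_integral_abs => //; first exact: mE.
  have -> : (\int[P]_x `|((f x - m) ^+ 2)%:E|)%E =
            (\int[P]_x ((f x - m) ^+ 2)%:E)%E.
    by apply: eq_integral => x _; rewrite gee0_abs// lee_fin sqr_ge0.
  rewrite -[LHS]fineK; last exact/integrable_fin_num/probability_integrable.
  by rewrite -[fine _]/(\int[P]_x ((f x - m) ^+ 2)) -Var_centered// V0.
have aeE (g : R -> R) : bounded_measurable (fun x => g (f x)) ->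
    \int[P]_x g (f x) = g m.
  move=> bg; rewrite -[RHS](mean_cst P); congr fine.
  apply: ae_eq_integral => //; first exact: mE.
  apply: filterS fm => x /(_ I) [] /eqP.
  by rewrite sqrf_eq0 subr_eq0 => /eqP fxm _; rewrite fxm.
rewrite /Ent (aeE (fun y => y ^+ 2 * ln (y ^+ 2))); last first.
  by apply: bounded_measurable_xlnx => // x; exact: sqr_ge0.
by rewrite (aeE (fun y => y ^+ 2))// subrr.
Qed.

End VarianceEntropy.

(** * Regularity and energy of C^1 functions *)

Lemma continuous_bounded_measurable (R : realType) (T : ptopologicalType)
  (f : T -> R) : compact [set: T] -> continuous f ->
  bounded_measurable (f : borel T -> R).
Proof.
move=> cT cf; split.
  apply: (measurability _ (RGenOpens.measurableE R)) => _ [_ [a [b ->]] <-].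
  rewrite setTI; apply: sub_sigma_algebra.
  by apply: open_comp => [x _|]; [exact: cf|exact: interval_open].
have cfT : {within [set: T], continuous f} by exact: continuous_subspaceT.
have [M [_ fM]] := compact_bounded (continuous_compact cfT cT).
by exists (M + 1) => x; apply: (fM (M + 1)); [rewrite ltrDl|exists x].
Qed.

(** Around [x] the function is the composition of a chart with a local C^1
    extension of its coordinate expression. *)
Lemma C1_fun_continuous (R : realType) (d : nat) (T : ptopologicalType)
  (M : manifold R d T) (f : T -> R) : C1_fun M f -> continuous f.
Proof.
move=> f1 x; set i := chart_at M x.
have xi : cdom i x by exact: chart_atP.
have [|U [F [oU Ux [Fc _] FE]]] := f1 i (cmap i x); first by exists x.
have cx : {for x, continuous (cmap i)}.
  by have := @cmap_continuous _ _ _ M i;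
    rewrite continuous_open_subspace; [apply; rewrite inE|exact: cdom_open].
have Fcx : (F \o cmap i) @ x --> (F \o cmap i) x.
  by apply: continuous_comp => //; exact: Fc.
have nE : \near x, F (cmap i x) = f x.
  near=> y; have yi : cdom i y.
    by near: y; apply: open_nbhs_nbhs; split => //; exact: cdom_open.
  rewrite FE /= ?cmapK//; last by exists y.
  by near: y; apply: cx; apply: open_nbhs_nbhs.
rewrite /continuous_at -(nbhs_singleton nE).
by apply: cvg_trans Fcx; apply: near_eq_cvg.
Unshelve. all: by end_near. Qed.

(** The difference quotients of the two functions coincide. *)
Lemma deriveDcst (R : realType) (V W : normedModType R) (f : V -> W) (c : W) v :
  (fun x => 'D_v (fun y => f y + c) x) = (fun x => 'D_v f x).
Proof.
apply/funext => x; rewrite /derive /=.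
by under eq_fun do rewrite opprD addrACA subrr addr0.
Qed.

Lemma C1_funDcst (R : realType) (d : nat) (T : ptopologicalType)
  (M : manifold R d T) (f : T -> R) (c : R) :
  C1_fun M f -> C1_fun M (fun x => f x + c).
Proof.
move=> f1 i u ui; have [U [F [oU Uu [Fc F1] FE]]] := f1 i u ui.
exists U, (fun y => F y + c); split => //; last first.
  by move=> y Uy yi; rewrite FE.
split=> [x Ux|v].
  exact: cvgD (Fc x Ux) (cvg_cst c).
have [dF cF] := F1 v; rewrite deriveDcst; split => // x Ux.
have := dF x Ux; rewrite /derivable /=.
by under [in X in _ -> X]eq_fun do rewrite opprD addrACA subrr addr0.
Qed.

Lemma energyDcst (R : realType) (d : nat) (T : ptopologicalType)
  (M : manifold R d T) (g : riemannian M)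
  (mu : {measure set (borel T) -> \bar R}) (f : T -> R) (c : R) :
  energy g mu (fun x => f x + c) = energy g mu f.
Proof.
have derive_inDcst (A : set 'rV[R]_d) (h : 'rV[R]_d -> R^o) v u :
    derive_in A v (fun y => h y + c) u = derive_in A v h u.
  rewrite /derive_in.
  by under eq_fun do rewrite opprD addrACA subrr addr0.
suff h : grad_sqnorm g (fun x => f x + c) = grad_sqnorm g f.
  by rewrite /energy h.
apply/funext => x; rewrite /grad_sqnorm; congr (sqnorm_at g x _).
rewrite /grad; congr (_ *m _).
by apply/rowP => a; rewrite !mxE derive_inDcst.
Qed.

Lemma energy_ge0 (R : realType) (d : nat) (T : ptopologicalType)
  (M : manifold R d T) (g : riemannian M)
  (mu : {measure set (borel T) -> \bar R}) (f : T -> R) : 0 <= energy g mu f.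
Proof.
rewrite /energy Rintegral_ge0// => x _; rewrite /grad_sqnorm /sqnorm_at.
have [->|v0] := eqVneq (grad g f x) 0; first by rewrite !mul0mx mxE.
by apply: ltW; apply: metric_pos => //; exact: chart_atP.
Qed.

Lemma le_fin_eqNy (R : realType) (x : \bar R) :
  (forall r : R, (x <= r%:E)%E) -> x = -oo%E.
Proof.
case: x => [s| |] // h; last by have := h 0; rewrite leye_eq.
by have := h (s - 1); rewrite lee_fin => ?; exfalso; lra.
Qed.

(** * Optimal constants *)

Section OptimalConstant.
Context (R : realType) (d : nat) (T : ptopologicalType) (M : manifold R d T).
Implicit Types (Phi E : (T -> R) -> R) (C : R).

Lemma optimal_constant_le Phi E C :
  (forall f, C1_fun M f -> Phi f <= C * E f) ->
  (optimal_constant M Phi E <= C%:E)%E.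
Proof. by move=> h; apply: ereal_inf_lbound; exists C. Qed.

Lemma optimal_constant_lt Phi E C : (forall f, 0 <= E f) ->
  (optimal_constant M Phi E < C%:E)%E ->
  forall f, C1_fun M f -> Phi f <= C * E f.
Proof.
move=> E0 /ereal_inf_lt[_ [C' hC' <-]]; rewrite lte_fin => CC' f f1.
by rewrite (le_trans (hC' f f1))// ler_wpM2r// ltW.
Qed.

(** A finite optimal constant is attained: larger constants are admissible
    since the energy is nonnegative, and they can be taken to the limit. *)
Lemma optimal_constant_fin Phi E C : (forall f, 0 <= E f) ->
  optimal_constant M Phi E = C%:E ->
  forall f, C1_fun M f -> Phi f <= C * E f.
Proof.
move=> E0 eC f f1.
have h e : 0 < e -> Phi f <= (C + e) * E f.
  by move=> e0; apply: optimal_constant_lt => //; rewrite eC lte_fin ltrDl.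
apply/ler_addgt0Pr => e e0.
have E1 : 0 < E f + 1 by rewrite ltr_wpDl.
apply: le_trans (h (e / (E f + 1)) (divr_gt0 e0 E1)) _.
rewrite mulrDl lerD2l mulrAC ler_pdivrMr// ler_pM2l// lerDl.
exact: ler01.
Qed.

End OptimalConstant.

(** * Poincare and logarithmic Sobolev constants *)

Section PoincareLogSobolev.
Context (R : realType) (d : nat) (T : ptopologicalType) (M : manifold R d T).
Variables (g : riemannian M) (cT : compact [set: T]).
Implicit Types P : probability (borel T) R.

Let C1_bounded (f : T -> R) : C1_fun M f -> bounded_measurable (f : borel T -> R).
Proof.
by move=> f1; apply: continuous_bounded_measurable => //; exact: C1_fun_continuous f1.
Qed.

(** Adding a large constant to [f] changes neither its variance nor its energy
    and brings it to the range of [Var_le_Ent]. *)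
Lemma poincare_of_logsobolev P (C : R) :
  (forall f, C1_fun M f -> Ent P (fun x => f x ^+ 2) <= C * energy g P f) ->
  forall f, C1_fun M f -> Var P f <= C * energy g P f.
Proof.
move=> hC f f1; have bf := C1_bounded f1.
have [_ [B fB]] := bf.
rewrite -(VarD P (B + 1) bf) -(energyDcst g P f (B + 1)).
have f1' := C1_funDcst (B + 1) f1.
apply: le_trans (hC _ f1'); apply: Var_le_Ent; first exact: C1_bounded.
by move=> x; have := fB x; rewrite ler_norml => /andP[? _]; lra.
Qed.

Lemma poincare_constant_le P :
  (poincare_constant g P <= logsobolev_constant g P)%E.
Proof.
apply: ereal_inf_le_tmp => _ [C hC <-].
by exists C => //; exact: poincare_of_logsobolev.
Qed.

(** Every real constant is then admissible, which forces the energy and the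
    variance of every C^1 function to vanish. *)
Lemma poincare_constant_Ny P :
  poincare_constant g P = -oo%E -> logsobolev_constant g P = -oo%E.
Proof.
move=> P_Ny; have VE (C : R) f : C1_fun M f -> Var P f <= C * energy g P f.
  by apply: optimal_constant_lt => [h|]; [exact: energy_ge0|rewrite -/(poincare_constant g P) P_Ny ltNyr].
apply: le_fin_eqNy => C; apply: optimal_constant_le => f f1.
have bf := C1_bounded f1; have V0 := Var_ge0 P bf.
have Ef0 : energy g P f = 0.
  by have := VE (-1) f f1; have := energy_ge0 g P f; lra.
have Vf0 : Var P f = 0 by have := VE 0 f f1; lra.
by rewrite (Ent_eq0_of_Var bf Vf0) Ef0 mulr0.
Qed.

Lemma mixture_logsobolev_le (P Q : probability (borel T) R) (K L K1 l p : R)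
  (a : {i01 R}) : 0 < a%:num -> a%:num < 1 ->
  (forall f, C1_fun M f -> Var Q f <= K * energy g P f) ->
  (forall f, C1_fun M f -> Ent Q (fun x => f x ^+ 2) <= L * energy g P f) ->
  (forall f, C1_fun M f ->
    (\int[P]_x f x - \int[Q]_x f x) ^+ 2 <= K1 * energy g P f) ->
  (forall f, C1_fun M f -> Ent P (fun x => f x ^+ 2) <= l * energy g P f) ->
  (forall f, C1_fun M f -> Var P f <= p * energy g P f) ->
  (mixture_logsobolev_constant g a P Q <=
   (l + (1 - a%:num) / a%:num * L
    + (1 - a%:num) * log_quotient a%:num * (p + K + K1))%:E)%E.
Proof.
move=> a0 a1 hK hL hK1 hl hp; apply: optimal_constant_le => f f1.
apply: le_trans (Ent_mixture_le P Q a0 a1 (C1_bounded f1)) _.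
set E := energy g P f; set t := a%:num in a0 a1 *.
have a1' : 0 <= 1 - t by rewrite subr_ge0 ltW.
have c0 : 0 <= t * (1 - t) * log_quotient t.
  by rewrite !mulr_ge0 ?(ltW a0)// ltW// log_quotient_gt0.
have -> : (l + (1 - t) / t * L + (1 - t) * log_quotient t * (p + K + K1)) *
    (t * E) = t * (l * E) + (1 - t) * (L * E) +
      t * (1 - t) * log_quotient t * (p * E + K * E + K1 * E).
  by field; rewrite gt_eqF.
rewrite !lerD// ?ler_wpM2l ?(ltW a0) ?hl ?hL//.
by rewrite !lerD// ?hp ?hK ?hK1.
Qed.

End PoincareLogSobolev.

Unset Implicit Arguments.

(** * Logarithmic Sobolev constant of the mixture *)

Theorem proposition5p1 (R : realType) (d : nat) (hd : (2 <= d)%N)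
  (T : ptopologicalType) (M : manifold R d T) (g : riemannian M)
  (hT : hausdorff_space T) (cT : compact [set: T])
  (conT : connected [set: T])
  (bT0 : boundary M !=set0) (conbT : connected (boundary M))
  (lamO lamB : probability (borel T) R)
  (hlamO : is_normalised_volume g lamO)
  (hlamB : is_normalised_boundary_measure g lamB)
  (K L K1 : R)
  (hK : forall f : T -> R, C1_fun M f -> Var lamB f <= K * energy g lamO f)
  (hL : forall f : T -> R, C1_fun M f ->
    Ent lamB (fun x => f x ^+ 2) <= L * energy g lamO f)
  (hK1 : forall f : T -> R, C1_fun M f ->
    (\int[lamO]_x f x - \int[lamB]_x f x) ^+ 2 <= K1 * energy g lamO f)
  (alpha : R) (alpha_gt0 : 0 < alpha) (alpha_lt1 : alpha < 1) :
  (mixture_logsobolev_constant g (Itv01 (ltW alpha_gt0) (ltW alpha_lt1))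
      lamO lamB
    <= logsobolev_constant g lamO
       + ((1 - alpha) / alpha * L)%:E
       + ((1 - alpha) * log_quotient alpha)%:E
         * (poincare_constant g lamO + K%:E + K1%:E))%E.
Proof.
have E0 f : 0 <= energy g lamO f by exact: energy_ge0.
have c0 : 0 < (1 - alpha) * log_quotient alpha.
  by rewrite mulr_gt0 ?subr_gt0// log_quotient_gt0.
have key l p := mixture_logsobolev_le (l := l) (p := p)
  (a := Itv01 (ltW alpha_gt0) (ltW alpha_lt1)) cT alpha_gt0 alpha_lt1 hK hL hK1.
have le_PL := poincare_constant_le g cT lamO.
have PNy := poincare_constant_Ny (g := g) (P := lamO) cT.
case eP : (poincare_constant g lamO) PNy le_PL => [p| |] PNy le_PL.
- case eL : (logsobolev_constant g lamO) le_PL => [l| |] le_PL //.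
  + apply: key; first exact: optimal_constant_fin E0 eL.
    exact: optimal_constant_fin E0 eP.
  + by rewrite leey.
- move: le_PL; rewrite leye_eq => /eqP ->.
  rewrite [(+oo + K%:E)%E]addye// [(+oo + K1%:E)%E]addye//.
  by rewrite gt0_muley ?lte_fin// !addye// leey.
(* Both constants are [-oo]: any [p] and [l] are admissible, and [p = 0] with a
   suitable [l] brings the bound of [key] below an arbitrary real number. *)
- have eL := PNy erefl; rewrite eL !addNye.
  suff -> : mixture_logsobolev_constant g
      (Itv01 (ltW alpha_gt0) (ltW alpha_lt1)) lamO lamB = -oo%E by rewrite leNye.
  apply: le_fin_eqNy => r.
  set b := (1 - alpha) / alpha * L.
  set c := (1 - alpha) * log_quotient alpha.
  have := key (r - b - c * (0 + K + K1)) 0.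
  rewrite -/b -/c => /(_ _ _)/le_trans; apply.
  + by apply: optimal_constant_lt => //; rewrite -/(logsobolev_constant g lamO) eL ltNyr.
  + by apply: optimal_constant_lt => //; rewrite -/(poincare_constant g lamO) eP ltNyr.
  + by rewrite lee_fin -/b -/c; lra.
Qed.
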